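(* Let $D$ be an infinite commutative unital Noetherian integral domain, and let $I$ be the ideal of weak graded identities of $D\langle X\rangle$ generated by $[y_1,y_2]=y_1y_2-y_2y_1$, $z_1z_2z_3-z_3z_2z_1$ and $y_1z_1+z_1y_1$ (equivalently, $I=Id(M_2(D),sl_2(D))$). Then every ideal of weak graded identities $J\subseteq D\langle X\rangle$ with $I\subseteq J$ is finitely generated as an ideal of weak graded identities, i.e. there is a finite set $S\subseteq J$ such that $J$ is the smallest ideal of weak graded identities containing $S$. In other words, the weak graded identities of $(M_2(D),sl_2(D))$ satisfy the Specht property.
   Context: Let $Y=\{y_1,y_2,\dots\}$ and $Z=\{z_1,z_2,\dots\}$ be disjoint countable sets of variables, $X=Y\cup Z$, and $D\langle X\rangle$ the free unital associative $D$-algebra on $X$, $\mathbb{Z}_2$-graded with the $y_i$ even and the $z_i$ odd. Let $L\langle X\rangle$ be the Lie subalgebra of $D\langle X\rangle$ (bracket $[a,b]=ab-ba$) generated by $X$, with induced grading $L\langle X\rangle^{(0)}\oplus L\langle X\rangle^{(1)}$. An ideal of weak graded identities is a two-sided ideal $J$ of $D\langle X\rangle$ closed under every algebra endomorphism of $D\langle X\rangle$ mapping each $y_i$ into $L\langle X\rangle^{(0)}$ and each $z_i$ into $L\langle X\rangle^{(1)}$; the ideal of weak graded identities generated by a set of polynomials is the smallest such ideal containing it. $M_2(D)$ is graded with diagonal matrices even and off-diagonal matrices odd; $sl_2(D)$ is the Lie algebra of traceless matrices with the induced grading; $Id(M_2(D),sl_2(D))$ is the set of polynomials vanishing under every substitution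 of each $y_i$ by an even element of $sl_2(D)$ and each $z_j$ by an odd element of $sl_2(D)$. *)

(* Defs.v *)
From HB Require Import structures.
From mathcomp Require Import all_boot all_order all_algebra.
From mathcomp Require Import finmap.
From mathcomp.multinomials Require Import monalg.
Set Implicit Arguments. Unset Strict Implicit. Unset Printing Implicit Defensive.
Import GRing.Theory.
Local Open Scope ring_scope.

(* Variables: [inl i] is y_(i+1) (even), [inr i] is z_(i+1) (odd). *)
Definition var := (nat + nat)%type.

Definition freealg (D : idomainType) := {malg D[{fmonom var}]}.

Definition xvar (D : idomainType) (x : var) : freealg D := << fmu x >>.
Definition yv (D : idomainType) (i : nat) : freealg D := xvar D (inl i).
Definition zv (D : idomainType) (i : nat) : freealg D := xvar D (inr i).

Definition lie_br (D : idomainType) (a b : freealg D) : freealg D :=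
  a * b - b * a.

Definition subst (D : idomainType) (phi : var -> freealg D) (p : freealg D)
  : freealg D :=
  \sum_(m <- msupp p) p@_m *: \prod_(x <- (m : seq var)) phi x.

(* Homogeneous components of the Lie subalgebra L<X> generated by X:
   [@LieComp D false] = L<X>^(0), [@LieComp D true] = L<X>^(1). *)
Inductive LieComp (D : idomainType) : bool -> freealg D -> Prop :=
  | Lie_y i : @LieComp D false (yv D i)
  | Lie_z i : @LieComp D true (zv D i)
  | Lie_0 b : @LieComp D b 0
  | Lie_add b p q : @LieComp D b p -> @LieComp D b q -> @LieComp D b (p + q)
  | Lie_scale b (c : D) p : @LieComp D b p -> @LieComp D b (c *: p)
  | Lie_br b1 b2 p q : @LieComp D b1 p -> @LieComp D b2 q ->
      @LieComp D (addb b1 b2) (lie_br p q).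

Definition graded_subst (D : idomainType) (phi : var -> freealg D) : Prop :=
  (forall i, @LieComp D false (phi (inl i))) /\
  (forall i, @LieComp D true (phi (inr i))).

Definition twosided_ideal (D : idomainType) (J : freealg D -> Prop) : Prop :=
  [/\ J 0,
      (forall p q, J p -> J q -> J (p + q)),
      (forall a p, J p -> J (a * p)) &
      (forall a p, J p -> J (p * a))].

Definition wg_ideal (D : idomainType) (J : freealg D -> Prop) : Prop :=
  twosided_ideal J /\
  (forall phi p, graded_subst phi -> J p -> J (subst phi p)).

Definition wg_generated (D : idomainType) (S : freealg D -> Prop)
  (p : freealg D) : Prop :=
  forall J, wg_ideal J -> (forall q, S q -> J q) -> J p.

Definition I_gens (D : idomainType) (p : freealg D) : Prop :=
  p = lie_br (yv D 0) (yv D 1) \/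
  p = zv D 0 * zv D 1 * zv D 2 - zv D 2 * zv D 1 * zv D 0 \/
  p = yv D 0 * zv D 0 + zv D 0 * yv D 0.

Definition I_ideal (D : idomainType) := wg_generated (@I_gens D).

Definition ring_ideal (D : idomainType) (A : D -> Prop) : Prop :=
  [/\ A 0, (forall a b, A a -> A b -> A (a + b)) &
      (forall c a, A a -> A (c * a))].

Definition noetherian (D : idomainType) : Prop :=
  forall A : nat -> D -> Prop,
    (forall n, ring_ideal (A n)) ->
    (forall n x, A n x -> A n.+1 x) ->
    exists N, forall n x, (N <= n)%N -> A n x -> A N x.

Definition infinite_type (T : eqType) : Prop :=
  forall s : seq T, exists x, x \notin s.

(* Main.v *)
(* Modulo [I] the even letters commute with each other, anticommute with the odd
   ones, and odd letters two places apart can be exchanged, so up to sign a word is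
   determined by three multisets: its y's, the z's in odd position and the z's in
   even position. Left multiplication by words with an even number of z's and
   renaming of variables along increasing maps act on these multisets by addition
   and relabelling, hence strictly monotonically for the colexicographic
   well-order, and by Higman's lemma the induced divisibility of words is a well
   quasi-order. A Hilbert basis argument on leading coefficients then applies:
   choosing p_0, p_1, ... in J with minimal leading words, each p_n outside the
   ideal generated by I and the earlier ones, one finds a subsequence with
   successively dividing leading words, whose leading coefficients contradict
   noetherianity. *)

From Stdlib Require Import Classical IndefiniteDescription Inverse_Image.
Require Import Defs.
From HB Require Import structures.
From mathcomp Require Import all_boot all_order all_algebra.
From mathcomp Require Import finmap.
From mathcomp.multinomials Require Import monalg.
From mathcomp Require Import zify.
Set Implicit Arguments. Unset Strict Implicit. Unset Printing Implicit Defensive.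

(** * Well quasi-orders and Higman's lemma *)

Lemma wf_minimal T (R : T -> T -> Prop) (P : T -> Prop) :
  well_founded R -> (exists x, P x) -> exists2 x, P x & forall y, P y -> ~ R y x.
Proof.
move=> wfR [x0 Px0]; apply: NNPP => nomin.
elim/(well_founded_ind wfR): x0 Px0 => x IH Px.
by apply: nomin; exists x => // y Py Ryx; apply: IH Py.
Qed.

Lemma wf_ltn_measure T (f : T -> nat) : well_founded (fun x y => f x < f y).
Proof.
suff acc n x : f x < n -> Acc (fun x y => f x < f y) x by move=> x; apply: (acc (f x).+1).
elim: n x => [|n IH] x; first by rewrite ltn0.
rewrite ltnS => lexn; apply: Acc_intro => y ltyx; apply: IH.
exact: leq_trans lexn.
Qed.

Lemma homo_ltn_of_succ (g : nat -> nat) :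
  (forall i, g i < g i.+1) -> {homo g : i j / i < j}.
Proof.
move=> gS i j; elim: j => // j IH; rewrite ltnS leq_eqVlt => /predU1P [->|/IH] //.
by move=> lt; apply: ltn_trans lt (gS j).
Qed.

Definition good_pairs A (R : A -> A -> Prop) :=
  forall s : nat -> A, exists i j, i < j /\ R (s i) (s j).

Definition ascending_subseqs A (R : A -> A -> Prop) :=
  forall s : nat -> A, exists2 g : nat -> nat,
    {homo g : i j / i < j} & forall i j, i < j -> R (s (g i)) (s (g j)).

(** Infinitely many terminal indices, those related to no later one, would form a sequence without
    good pairs. So from some [N] on every index has a related later one; iterating that choice and
    using transitivity gives the subsequence. *)
Lemma good_pairs_ascending A (R : A -> A -> Prop) :
  (forall y x z, R x y -> R y z -> R x z) -> good_pairs R -> ascending_subseqs R.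
Proof.
move=> Rtr Rgood s.
pose terminal i := forall j, i < j -> ~ R (s i) (s j).
have [N Nterm] : exists N, forall i, N <= i -> ~ terminal i.
  apply: NNPP => inf_term.
  have /functional_choice [h hP] : forall N, exists i, N <= i /\ terminal i.
    move=> N; apply: NNPP => noi; apply: inf_term; exists N => i Ni ti.
    by apply: noi; exists i.
  pose g := fix g k := if k is k'.+1 then h (g k').+1 else h 0.
  have g_term k : terminal (g k) by case: k => [|k]; [case: (hP 0) | case: (hP (g k).+1)].
  have g_inc : {homo g : i j / i < j}.
    by apply: homo_ltn_of_succ => i; case: (hP (g i).+1).
  have [i [j [ltij Rij]]] := Rgood (s \o g).
  exact: g_term (g_inc _ _ ltij) Rij.
have /functional_choice [nx nxP] : forall i, exists j,
    N <= i -> i < j /\ R (s i) (s j).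
  move=> i; case: (classic (N <= i)) => [Ni|]; last by exists 0.
  apply: NNPP => noj; apply: (Nterm i Ni) => j ltij Rij.
  by apply: noj; exists j.
pose g k := iter k nx N.
have gN k : N <= g k.
  elim: k => [|k IH]; first exact: leqnn.
  by case: (nxP _ IH) => /ltnW le _; apply: leq_trans IH le.
exists g => [|i j].
  by apply: homo_ltn_of_succ => i; case: (nxP _ (gN i)).
elim: j => // j IH; rewrite ltnS leq_eqVlt => /predU1P [->|/IH Rij].
  by case: (nxP _ (gN j)).
by apply: Rtr Rij _; case: (nxP _ (gN j)).
Qed.

Lemma leq_ascending : ascending_subseqs leq.
Proof.
apply: good_pairs_ascending => [y x z|s]; first exact: leq_trans.
apply: NNPP => bad.
(* Without good pairs the sequence is strictly decreasing, so it drops by at least one at each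
   step. *)
have desc k : s k + k <= s 0.
  elim: k => [|k IH]; first by rewrite addn0.
  rewrite addnS; apply: leq_trans IH; rewrite ltn_add2r ltnNge.
  by apply/negP => le; apply: bad; exists k, k.+1.
by have := desc (s 0).+1; lia.
Qed.

Lemma prod_ascending A B (R : A -> A -> Prop) (S : B -> B -> Prop) :
  ascending_subseqs R -> ascending_subseqs S ->
  ascending_subseqs (fun x y => R x.1 y.1 /\ S x.2 y.2).
Proof.
move=> RP SP s; have [g ginc gP] := RP (fst \o s).
have [h hinc hP] := SP (snd \o s \o g).
exists (g \o h) => [i j ltij|i j ltij /=]; first exact: ginc (hinc _ _ ltij).
by split; [apply: gP; apply: hinc | apply: hP].
Qed.

Lemma preim_ascending A B (f : A -> B) (R : B -> B -> Prop) :
  ascending_subseqs R -> ascending_subseqs (fun x y => R (f x) (f y)).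
Proof. by move=> RP s; have [g ginc gP] := RP (f \o s); exists g. Qed.

Lemma sub_ascending A (R S : A -> A -> Prop) :
  (forall x y, R x y -> S x y) -> ascending_subseqs R -> ascending_subseqs S.
Proof. by move=> RS RP s; have [g ginc gP] := RP s; exists g => // i j /gP /RS. Qed.

(** Equality of booleans is the product order pulled back along [b] to [(b, ~~ b)]: the second
    component reverses the first. *)
Lemma bool_ascending : ascending_subseqs (@eq bool).
Proof.
have := prod_ascending leq_ascending leq_ascending.
move=> /(preim_ascending (fun b : bool => (b : nat, (~~ b) : nat))).
by apply: sub_ascending => -[] [] //= [].
Qed.

Section MinimalBadSequence.
Variables (T : Type) (sz : T -> nat) (R : T -> T -> Prop).

Definition bad_seq (t : nat -> T) := forall i j, i < j -> ~ R (t i) (t j).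

(** Nash-Williams's construction: [step] turns a bad sequence into one that agrees with it below [k]
    and has the smallest possible [k]-th term. The iterates [u] stabilise at each index, and their
    diagonal is the minimal bad sequence. *)
Lemma minimal_bad_seq : ~ good_pairs R ->
  exists2 t, bad_seq t & forall k t', bad_seq t' ->
    (forall i, i < k -> t' i = t i) -> sz (t k) <= sz (t' k).
Proof.
move=> notgood.
have [t0 bad0] : exists t, bad_seq t.
  apply: NNPP => nobad; apply: notgood => s; apply: NNPP => nogood.
  by apply: nobad; exists s => i j ltij Rij; apply: nogood; exists i, j.
have /functional_choice [step stepP] : forall x : nat * (nat -> T), exists t',
    bad_seq x.2 -> [/\ bad_seq t', (forall i, i < x.1 -> t' i = x.2 i) &
      forall t'', bad_seq t'' -> (forall i, i < x.1 -> t'' i = x.2 i) ->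
      sz (t' x.1) <= sz (t'' x.1)].
  move=> [k t] /=; case: (classic (bad_seq t)) => [badt|]; last by exists t.
  pose P t' := bad_seq t' /\ forall i, i < k -> t' i = t i.
  have [|t' [badt' agr] mint'] :=
    wf_minimal (P := P) (wf_ltn_measure (fun t : nat -> T => sz (t k))).
    by exists t.
  exists t' => _; split=> // t'' bad'' agr''; rewrite leqNgt; apply/negP.
  exact: mint'.
pose u := fix u k := if k is k'.+1 then step (k', u k') else t0.
have ubad k : bad_seq (u k) by elim: k => //= k /(stepP (k, _)) [].
have uS k i : i < k -> u k.+1 i = u k i.
  by have [_ + _] := stepP (k, u k) (ubad k); apply.
have u_stable i k : i < k -> u k i = u i.+1 i.
  elim: k => // k IH; rewrite ltnS leq_eqVlt => /predU1P [-> //|ltik].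
  by rewrite uS // IH.
exists (fun k => u k.+1 k) => [i j ltij|k t' bad' agr].
  by rewrite -(u_stable i j.+1) ?(ltn_trans ltij) //; apply: ubad.
have [_ _] := stepP (k, u k) (ubad k); apply => //= i ltik.
by rewrite agr // [RHS]u_stable.
Qed.
End MinimalBadSequence.

Definition finword A := (nat * (nat -> A))%type.

(** The position [f i] may exceed the length of [w]: only the source is cut off at its length. Since
    [f] increases on all naturals, it can later rename every variable. *)
Definition word_embeds A (R : A -> A -> Prop) (v w : finword A) :=
  exists2 f, {homo f : i j / i < j} & forall i, i < v.1 -> R (v.2 i) (w.2 (f i)).

(** In a minimal bad sequence [t] no word is empty. Take a subsequence [g] along which first letters
    ascend, keep [t] below [g 0], and continue with the tails of the words [t (g k)]. The result
    [t'] is still bad but shorter at [g 0], against minimality. *)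
Theorem higman A (R : A -> A -> Prop) :
  ascending_subseqs R -> good_pairs (word_embeds R).
Proof.
move=> RP; apply: NNPP => /(minimal_bad_seq fst) [t badt mint].
have tpos k : 0 < (t k).1.
  rewrite lt0n; apply/eqP => t0; apply: (badt k k.+1) => //.
  by exists id => //; rewrite t0.
have [g ginc gP] := RP (fun k => (t k).2 0).
pose tl (w : finword A) : finword A := (w.1.-1, fun i => w.2 i.+1).
pose t' k := if k < g 0 then t k else tl (t (g (k - g 0))).
have emb_tl v w : word_embeds R v (tl w) -> word_embeds R v w.
  by case=> f finc fP; exists (S \o f) => // i j /finc.
have bad' : bad_seq (word_embeds R) t'.
  move=> i j ltij; rewrite /t'; case: (ltnP j (g 0)) => [ltj|lej].
    by rewrite (ltn_trans ltij ltj); apply: badt.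
  case: (ltnP i (g 0)) => [lti|lei].
    (* The tail comes from the word of index [g (j - g 0)], which is at least [g 0] and so later
       than [i]. *)
    move=> /emb_tl; apply: badt; apply: leq_trans lti _.
    by case: (j - g 0) => // k; apply: ltnW; apply: ginc.
  have ltij' : i - g 0 < j - g 0 by rewrite ltn_sub2rE.
  case=> f finc fP; apply: (badt _ _ (ginc _ _ ltij')).
  (* An embedding of tails extends to whole words by matching the first letters, which are related
     along [g]. *)
  exists (fun i => if i is i'.+1 then (f i').+1 else 0) => [[|x] [|y] //|[|x] /= ltx].
    exact: (finc x y).
    exact: gP.
  by apply: (fP x); rewrite /= -ltnS prednK.
have : (t (g 0)).1 <= (t' (g 0)).1.
  by apply: mint => // i lti; rewrite /t' lti.
by rewrite /t' ltnn subnn /= leqNgt ltn_predL tpos.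
Qed.

(** * The colexicographic order on multisets *)

Lemma perm_eq_count_mem (T : eqType) (s t : seq T) :
  (forall x, count_mem x s = count_mem x t) -> perm_eq s t.
Proof. by move=> eq_st; apply/allP => x _; apply/eqP/eq_st. Qed.

Lemma count_mem_perm (T : eqType) (s t : seq T) x :
  perm_eq s t -> count_mem x s = count_mem x t.
Proof. by move/permP. Qed.

Lemma complement_of_count_le (T : eqType) (s t : seq T) :
  (forall x, count_mem x s <= count_mem x t) -> exists r, perm_eq (r ++ s) t.
Proof.
move=> le_st; have /count_subseqP [s' /perm_to_subseq [r tE] sE] := le_st.
by exists r; rewrite perm_sym (permPl tE) perm_catC perm_cat2l perm_sym.
Qed.

(** Provides an explicit bound on the support of a multiset: no entry exceeds the sum. *)
Lemma notin_sumn_lt (s : seq nat) i : sumn s < i -> i \notin s.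
Proof.
apply: contraTN => i_s; rewrite -leqNgt.
by elim: s i_s => //= a s IH; rewrite inE => /predU1P [->|/IH]; lia.
Qed.

(** Lists stand for multisets, compared at the largest value whose multiplicities differ. *)
Definition colex (s t : seq nat) := exists2 i,
  count_mem i s < count_mem i t & forall j, i < j -> count_mem j s = count_mem j t.

Lemma colex_trans t s r : colex s t -> colex t r -> colex s r.
Proof.
case=> i ilt igt [j jlt jgt]; exists (maxn i j) => [|k].
  case: (ltngtP i j) => [lt|lt|eq_ij]; first by rewrite igt.
    by rewrite -jgt.
  by subst j; apply: ltn_trans jlt.
by rewrite gtn_max => /andP [/igt -> /jgt].
Qed.

Lemma colex_perm s s' t t' :
  perm_eq s s' -> perm_eq t t' -> colex s t -> colex s' t'.
Proof.
move=> ss' tt' [i ilt igt]; exists i => [|j /igt].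
  by rewrite -(count_mem_perm i ss') -(count_mem_perm i tt').
by rewrite (count_mem_perm j ss') (count_mem_perm j tt').
Qed.

(** Induction on a bound [n] from which on the multiplicities agree: either they differ at the last
    value below [n], which decides, or the bound can be lowered. *)
Lemma colex_total s t : [\/ perm_eq s t, colex s t | colex t s].
Proof.
suff tot n : (forall j, n <= j -> count_mem j s = count_mem j t) ->
    [\/ perm_eq s t, colex s t | colex t s].
  apply: (tot (sumn s + sumn t).+1) => j lej.
  by rewrite !(count_memPn _) //; apply: notin_sumn_lt; lia.
elim: n => [|n IH] eqn; first by apply: Or31; apply: perm_eq_count_mem => x; apply: eqn.
case: (ltngtP (count_mem n s) (count_mem n t)) => [lt|gt|eq_n].
- by apply: Or32; exists n.
- by apply: Or33; exists n => // j ltnj; rewrite eqn.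
- by apply: IH => j; rewrite leq_eqVlt => /predU1P [<-|/eqn].
Qed.

Lemma colex_cat2l u s t : colex s t -> colex (u ++ s) (u ++ t).
Proof.
case=> i ilt igt; exists i => [|j /igt]; first by rewrite !count_cat ltn_add2l.
by rewrite !count_cat => ->.
Qed.

Lemma count_mem_map_inj (T U : eqType) (f : T -> U) x s :
  injective f -> count_mem (f x) (map f s) = count_mem x s.
Proof. by move=> finj; rewrite count_map; apply: eq_count => y /=; rewrite inj_eq. Qed.

Lemma homo_ltn_inj f : {homo f : i j / i < j} -> injective f.
Proof.
move=> finc x y fE; case: (ltngtP x y) => // /finc; by rewrite fE ltnn.
Qed.

Lemma colex_map f s t :
  {homo f : i j / i < j} -> colex s t -> colex (map f s) (map f t).
Proof.
move=> finc [i ilt igt]; have finj := homo_ltn_inj finc.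
exists (f i) => [|j ltij]; first by rewrite !count_mem_map_inj.
have [/mapP [k _ jE]|] := boolP (j \in map f (s ++ t)).
  have ltik : i < k.
    by rewrite ltnNge leq_eqVlt; apply/negP => /predU1P [E|/finc]; move: ltij;
       rewrite jE ?E ?ltnn // => /ltn_trans/[apply]; rewrite ltnn.
  by rewrite jE !count_mem_map_inj // igt.
by rewrite map_cat mem_cat negb_or => /andP [js jt]; rewrite !(count_memPn _).
Qed.

(** Induction on a strict bound for the entries. With entries at most [n], a descent either lowers
    the multiplicity of [n] or keeps it and lowers the part below [n], which is accessible by the
    outer induction; hence a nested induction on the two. *)
Lemma colex_wf : well_founded colex.
Proof.
suff acc n s : all (gtn n) s -> Acc colex s.
  move=> s; apply: (acc (sumn s).+1); apply/allP => i; apply: contraTT => /=.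
  by rewrite -leqNgt; apply: notin_sumn_lt.
elim: n s => [|n IHn] s.
  case: s => [_|i s]; last by rewrite /=.
  by apply: Acc_intro => r [i]; rewrite ltn0.
suff acc v t : Acc colex t -> forall s, t = filter (gtn n) s -> count_mem n s = v ->
    all (gtn n.+1) s -> Acc colex s.
  move=> s_n; apply: (acc _ (filter (gtn n) s) _ s erefl erefl s_n).
  exact/IHn/filter_all.
elim/ltn_ind: v t => v IHv t acc_t; elim: acc_t => {}t _ IHt {}s tE sv s_n.
apply: Acc_intro => r [i ilt igt].
have count_big j (q : seq nat) : all (gtn n.+1) q -> n < j -> count_mem j q = 0.
  move=> qn ltnj; apply/count_memPn/negP => /(allP qn) /=.
  by rewrite ltnNge -ltnS ltnS ltnj.
have lein : i <= n.
  by rewrite leqNgt; apply/negP => ltni; rewrite (count_big i s) in ilt.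
have r_n : all (gtn n.+1) r.
  apply/allP => j jr /=; rewrite ltnS leqNgt; apply/negP => ltnj.
  have := igt j (leq_ltn_trans lein ltnj).
  by rewrite (count_big j s) // => /count_memPn; rewrite jr.
move: lein; rewrite leq_eqVlt => /predU1P [iE|ltin].
  subst i; rewrite -sv in IHv.
  apply: (IHv _ ilt (filter (gtn n) r) _ r erefl erefl r_n).
  exact/IHn/filter_all.
have count_filt j q : count_mem j (filter (gtn n) q) =
    if j < n then count_mem j q else 0.
  rewrite count_filter; case: ifP => ltjn.
    by apply: eq_count => k /=; case: eqP => // ->.
  by apply/eqP; rewrite -leqn0 leqNgt -has_count; apply/hasPn => k _ /=;
     case: eqP => // ->; rewrite ltjn.
apply: (IHt (filter (gtn n) r) _ r erefl _ r_n); last by rewrite -sv igt.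
rewrite tE; exists i; first by rewrite !count_filt ltin.
by move=> j /igt; rewrite !count_filt; case: ifP.
Qed.

(** * Letter contents of words *)

Fixpoint y_letters (s : seq var) : seq nat :=
  match s with
  | [::] => [::]
  | inl i :: t => i :: y_letters t
  | inr _ :: t => y_letters t
  end.

(* [z_letters false s] lists the z's of [s] preceded by an even number of z's,
   [z_letters true s] those preceded by an odd number. *)
Fixpoint z_letters (b : bool) (s : seq var) : seq nat :=
  match s with
  | [::] => [::]
  | inl _ :: t => z_letters b t
  | inr j :: t => if b then z_letters false t else j :: z_letters true t
  end.

Definition is_z (x : var) := if x is inr _ then true else false.
Definition z_parity (s : seq var) := odd (count is_z s).

Definition same_content (s t : seq var) :=
  perm_eq (y_letters s) (y_letters t) /\
  forall b, perm_eq (z_letters b s) (z_letters b t).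

(** The three multisets are merged into one, separated by residues modulo 3. Keeping the three codes
    of an index adjacent makes an increasing renaming of indices act as an increasing map on
    codes. *)
Definition content (s : seq var) : seq nat :=
  [seq 3 * i | i <- y_letters s] ++ [seq 3 * i + 1 | i <- z_letters false s]
  ++ [seq 3 * i + 2 | i <- z_letters true s].

Definition rename (f : nat -> nat) (x : var) : var :=
  match x with inl i => inl (f i) | inr j => inr (f j) end.

Lemma y_letters_cat s t : y_letters (s ++ t) = y_letters s ++ y_letters t.
Proof. by elim: s => //= -[] i s ->. Qed.

Lemma z_letters_cat b s t :
  z_letters b (s ++ t) = z_letters b s ++ z_letters (b (+) z_parity s) t.
Proof.
rewrite /z_parity; elim: s b => [|[] i s IH] b /=; first by rewrite addbF.
  by rewrite IH.
by rewrite oddD /=; case: b; rewrite IH //= ?negbK; case: odd.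
Qed.

(** The z's alternate between the two position classes, starting with the one selected by
    [false]. *)
Lemma size_z_letters s :
  size (z_letters false s) = size (z_letters true s) + z_parity s.
Proof.
rewrite /z_parity; elim: s => [|[] i s IH] //=; rewrite oddD /= IH.
by case: odd; rewrite /= ?addn0 ?addn1.
Qed.

Lemma size_letters s :
  size s = size (y_letters s) + (size (z_letters false s) + size (z_letters true s)).
Proof. by elim: s => [|[] i s IH] //=; rewrite IH; lia. Qed.

Lemma y_letters_rename f s : y_letters (map (rename f) s) = map f (y_letters s).
Proof. by elim: s => //= -[] i s //= ->. Qed.

Lemma z_letters_rename f b s :
  z_letters b (map (rename f) s) = map f (z_letters b s).
Proof. by elim: s b => //= -[] i s IH [] /=; rewrite IH. Qed.

Lemma same_content_refl s : same_content s s.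
Proof. by split. Qed.

Lemma same_content_trans t s r :
  same_content s t -> same_content t r -> same_content s r.
Proof.
case=> sty stz [try trz]; split=> [|b]; first exact: perm_trans try.
exact: perm_trans (trz b).
Qed.

Lemma same_content_sym s t : same_content s t -> same_content t s.
Proof. by case=> sty stz; split=> [|b]; rewrite perm_sym. Qed.

Lemma same_content_cons x s t : same_content s t -> same_content (x :: s) (x :: t).
Proof. by case=> sty stz; case: x => i; split=> [|[]] //=; rewrite perm_cons. Qed.

Lemma same_content_size s t : same_content s t -> size s = size t.
Proof.
by case=> sty stz; rewrite !size_letters (perm_size sty) !(perm_size (stz _)).
Qed.

Lemma perm_content s t : same_content s t -> perm_eq (content s) (content t).
Proof. by case=> sty stz; rewrite !perm_cat // perm_map. Qed.

Lemma count_mem_content s i :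
  [/\ count_mem (3 * i) (content s) = count_mem i (y_letters s),
      count_mem (3 * i + 1) (content s) = count_mem i (z_letters false s) &
      count_mem (3 * i + 2) (content s) = count_mem i (z_letters true s)].
Proof.
have cnt (f : nat -> nat) x l : count_mem x (map f l) = count (fun k => f k == x) l.
  by rewrite count_map.
have cnt0 (f : nat -> nat) x l : (forall k, f k <> x) ->
    count (fun k => f k == x) l = 0.
  by move=> fx; rewrite -(count_pred0 l); apply: eq_count => k /=; apply/negbTE/eqP.
have cnt1 a x l : count (fun k => 3 * k + a == 3 * x + a) l = count_mem x l.
  by apply: eq_count => k /=; rewrite eqn_add2r eqn_pmul2l.
have cnt1' x l : count (fun k => 3 * k == 3 * x) l = count_mem x l.
  by apply: eq_count => k /=; rewrite eqn_pmul2l.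
rewrite /content !count_cat !cnt; split.
- by rewrite cnt1' [count _ (z_letters false s)]cnt0 1?[count _ (z_letters true s)]cnt0 ?addn0 //
    => k; lia.
- by rewrite cnt1 [count _ (y_letters s)]cnt0 1?[count _ (z_letters true s)]cnt0 ?addn0 //
    => k; lia.
- by rewrite cnt1 [count _ (y_letters s)]cnt0 1?[count _ (z_letters false s)]cnt0 // => k; lia.
Qed.

Lemma content_perm s t : perm_eq (content s) (content t) -> same_content s t.
Proof.
move=> st; split=> [|[]]; apply: perm_eq_count_mem => i;
  have [sy sf st'] := count_mem_content s i; have [ty tf tt] := count_mem_content t i.
- by rewrite -sy -ty; apply: count_mem_perm.
- by rewrite -st' -tt; apply: count_mem_perm.
- by rewrite -sf -tf; apply: count_mem_perm.
Qed.

(** An even number of z's in [u] leaves the position classes of the z's of [s] unchanged. *)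
Lemma perm_content_cat u s : z_parity u = false ->
  perm_eq (content (u ++ s)) (content u ++ content s).
Proof.
move=> u_even; rewrite /content y_letters_cat !z_letters_cat u_even /= !map_cat.
by apply: perm_eq_count_mem => x; rewrite !count_cat; lia.
Qed.

Lemma content_rename f s :
  content (map (rename f) s) = [seq 3 * f (n %/ 3) + n %% 3 | n <- content s].
Proof.
rewrite /content y_letters_rename !z_letters_rename !map_cat -!map_comp.
congr (_ ++ (_ ++ _)); apply: eq_map => i /=.
- by rewrite mulKn // modnMr addn0.
- rewrite (_ : (3 * i + 1) %/ 3 = i); lia.
- rewrite (_ : (3 * i + 2) %/ 3 = i); lia.
Qed.

Lemma colex_translate f u s t : {homo f : i j / i < j} -> z_parity u = false ->
  colex (content s) (content t) ->
  colex (content (u ++ map (rename f) s)) (content (u ++ map (rename f) t)).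
Proof.
move=> finc u_even st.
apply: (@colex_perm (content u ++ content (map (rename f) s)) _
                    (content u ++ content (map (rename f) t)));
  rewrite 1?perm_sym ?perm_content_cat //.
apply: colex_cat2l; rewrite !content_rename; apply: colex_map st => i j ltij.
have : i %/ 3 <= j %/ 3 by rewrite leq_div2r // ltnW.
rewrite leq_eqVlt => /predU1P [E|/finc]; last by lia.
by rewrite E ltn_add2l; lia.
Qed.

(** * Divisibility of words *)

Definition word_le (s t : seq var) :=
  z_parity s = z_parity t /\ exists2 f, {homo f : i j / i < j} & forall i,
    count_mem i (y_letters s) <= count_mem (f i) (y_letters t) /\
    forall b, count_mem i (z_letters b s) <= count_mem (f i) (z_letters b t).

Lemma word_le_trans t s r : word_le s t -> word_le t r -> word_le s r.
Proof.
case=> st [f finc fP] [tr [g ginc gP]]; split; first by rewrite st.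
exists (g \o f) => [i j /finc /ginc //|i].
have [fy fz] := fP i; have [gy gz] := gP (f i); split=> [|b].
  exact: leq_trans gy.
exact: leq_trans (gz b).
Qed.

(** A first subsequence makes the parity constant. A word is then read as a sequence of triples of
    multiplicities, indexed by variable indices, and Higman's lemma over triples of naturals
    supplies the increasing renaming. *)
Lemma word_le_ascending : ascending_subseqs word_le.
Proof.
apply: good_pairs_ascending => [|s]; first exact: word_le_trans.
have [g ginc gP] := preim_ascending z_parity bool_ascending s.
(* The length exceeds every index that occurs, so all multiplicities beyond it are zero. *)
pose fw w : finword (nat * (nat * nat)) :=
  ((sumn (y_letters w ++ z_letters false w ++ z_letters true w)).+1,
   fun i => (count_mem i (y_letters w),
             (count_mem i (z_letters false w), count_mem i (z_letters true w)))).
have := higman (prod_ascending leq_ascending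
                 (prod_ascending leq_ascending leq_ascending)).
case/(_ (fw \o s \o g)) => i [j [ltij [f finc fP]]].
exists (g i), (g j); split; first exact: ginc.
split; first exact: gP.
exists f => // k; case: (ltnP k (fw (s (g i))).1) => [/fP /= [? [? ?]]|].
  by split=> // -[].
move=> /notin_sumn_lt; rewrite !mem_cat !negb_or => /and3P [ky kf kt].
by rewrite (count_memPn ky); split=> // -[]; rewrite (count_memPn _).
Qed.

Lemma count_mem_map_le (T U : eqType) (f : T -> U) s t : injective f ->
  (forall i, count_mem i s <= count_mem (f i) t) ->
  forall j, count_mem j (map f s) <= count_mem j t.
Proof.
move=> finj le j; have [/mapP [i _ ->]|jn] := boolP (j \in map f s).
  by rewrite count_mem_map_inj.
by rewrite (count_memPn jn).
Qed.

Lemma word_le_divides s t : word_le s t -> exists f u,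
  [/\ {homo f : i j / i < j}, z_parity u = false &
      same_content (u ++ map (rename f) s) t].
Proof.
case=> st [f finc fP]; have finj := homo_ltn_inj finc.
have fy i := proj1 (fP i); have fz b i := proj2 (fP i) b.
have [y yP] := complement_of_count_le (count_mem_map_le finj fy).
have zP b := complement_of_count_le (count_mem_map_le finj (fz b)).
have [[c cP] [d dP]] := (zP false, zP true).
(* Equal parities force as many missing z's in odd as in even positions, so they can be paired. *)
have size_cd : size c = size d.
  have := size_z_letters s; have := size_z_letters t; rewrite st.
  have := perm_size cP; have := perm_size dP; rewrite !size_cat !size_map.
  move: (nat_of_bool _) (size c) (size d) => p sc sd.
  move: (size _) (size _) (size _) (size _) => a1 a2 a3 a4.
  lia.
(* Alternating the two lists puts the letters of [c] in odd and those of [d] in even positions. *)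
pose zz := flatten [seq [:: inr p.1; inr p.2] | p <- zip c d] : seq var.
have yzz : y_letters zz = [::] by rewrite /zz; elim: (zip c d).
have zzz : z_letters false zz = c /\ z_letters true zz = d.
  rewrite /zz; elim: c d size_cd {cP dP zz yzz} => [|i c IH] [|j d] //= [] /IH.
  by case=> -> ->.
have uy : y_letters (map inl y) = y by elim: (y) => //= i l ->.
have uz b : z_letters b (map inl y) = [::] by elim: (y).
have py : z_parity (map inl y) = false by rewrite /z_parity; elim: (y).
have pz : z_parity zz = false.
  by rewrite /z_parity /zz; elim: (zip c d) => //= p l IH; rewrite negbK.
exists f, (map inl y ++ zz); split=> //.
  by rewrite /z_parity count_cat oddD; move: py pz; rewrite /z_parity => -> ->.
split=> [|b].
  by rewrite !y_letters_cat uy yzz cats0 y_letters_rename.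
rewrite -catA !z_letters_cat uz /= py addbF pz addbF z_letters_rename.
by case: zzz => zf zt; case: b; rewrite ?zf ?zt.
Qed.

(** * Leading words modulo [I] *)

Import GRing.Theory.
Local Open Scope ring_scope.

(** * Words and substitutions in the free algebra *)

Section FreeAlgebra.
Variable D : idomainType.
Implicit Types (p q : freealg D) (s t : seq var) (phi : var -> freealg D).

Definition mon s : freealg D := << FMonom s >>.

Lemma mon_cat s t : mon (s ++ t) = mon s * mon t.
Proof. by rewrite malgM_def /mon fgmulUU mulr1; congr << _ *g _ >>; exact/esym/fmmulE. Qed.

Lemma scalerAr_malg c p q : c *: (p * q) = p * (c *: q).
Proof.
pose C : freealg D := @malgC {fmonom var} D c.
have CM r : c *: r = C * r by rewrite mul_malgC.
have CC : C * p = p * C.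
  rewrite !malgM_def fgmulUg fgmulgU; apply: eq_bigr => m _.
  by rewrite mulrC mul1m mulm1.
by rewrite [LHS]CM (CM q) [LHS]mulrA CC -mulrA {CM CC}.
Qed.

Lemma xvarE x : xvar D x = mon [:: x].
Proof. by rewrite /xvar fmuE. Qed.

Lemma monalg_monE p : p = \sum_(m <- msupp p) p@_m *: mon m.
Proof.
rewrite [LHS]monalgE; apply: eq_bigr => m _.
rewrite -mul_malgC malgM_def fgmulUU mulr1 fmK; congr << _ *g _ >>.
exact/esym/fmmul1m.
Qed.

(** Gives access to the additivity of [mmap]. *)
Lemma substE phi p :
  subst phi p = mmap (@malgC {fmonom var} D)
    (fun m : {fmonom var} => \prod_(x <- (m : seq var)) phi x) p.
Proof. by apply: eq_bigr => m _; rewrite mul_malgC. Qed.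

Lemma substD phi p q : subst phi (p + q) = subst phi p + subst phi q.
Proof. by rewrite !substE mmapD. Qed.

Lemma substB phi p q : subst phi (p - q) = subst phi p - subst phi q.
Proof. by rewrite !substE mmapB. Qed.

Lemma substZ phi c p : subst phi (c *: p) = c *: subst phi p.
Proof.
rewrite substE (mmapEw (msuppZ_le _ _)) /subst scaler_sumr.
by apply: eq_bigr => m _; rewrite mul_malgC mcoeffZ scalerA.
Qed.

Lemma subst_mon phi s : subst phi (mon s) = \prod_(x <- s) phi x.
Proof. by rewrite substE mmapU mul1r. Qed.

Lemma subst_xvar_mon (r : var -> var) s :
  subst (fun x => xvar D (r x)) (mon s) = mon (map r s).
Proof.
rewrite subst_mon; elim: s => [|x s IH]; first by rewrite big_nil /mon -fmoneE.
by rewrite big_cons IH xvarE -mon_cat.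
Qed.

Lemma graded_xvar (r : var -> var) : (forall x, is_z (r x) = is_z x) ->
  graded_subst (fun x => xvar D (r x)).
Proof.
move=> rP; split=> i.
  by have := rP (inl i); case: (r (inl i)) => j // _; apply: Lie_y.
by have := rP (inr i); case: (r (inr i)) => j // _; apply: Lie_z.
Qed.

Lemma wg_generated_wg_ideal S : wg_ideal (@wg_generated D S).
Proof.
split; first split.
- by move=> J [[]].
- move=> p q Gp Gq J Jwg SJ; have [[_ JD _ _] _] := Jwg.
  by apply: JD; [apply: Gp | apply: Gq].
- by move=> a p Gp J Jwg SJ; have [[_ _ JM _] _] := Jwg; apply: JM; apply: Gp.
- by move=> a p Gp J Jwg SJ; have [[_ _ _ JM] _] := Jwg; apply: JM; apply: Gp.
- by move=> phi p gphi Gp J Jwg SJ; have [_ Js] := Jwg; apply: Js => //; apply: Gp.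
Qed.

Section Ideal.
Variables (J : freealg D -> Prop) (Jwg : wg_ideal J).

Lemma ideal0 : J 0. Proof. by case: Jwg => [[]]. Qed.
Lemma idealD p q : J p -> J q -> J (p + q). Proof. by case: Jwg => [[_ JD _ _] _]; apply: JD. Qed.
Lemma idealMl a p : J p -> J (a * p). Proof. by case: Jwg => [[_ _ JM _] _]; apply: JM. Qed.
Lemma idealMr a p : J p -> J (p * a). Proof. by case: Jwg => [[_ _ _ JM] _]; apply: JM. Qed.
Lemma idealZ c p : J p -> J (c *: p). Proof. by rewrite -mul_malgC; apply: idealMl. Qed.
Lemma idealN p : J p -> J (- p). Proof. by rewrite -scaleN1r; apply: idealZ. Qed.
Lemma idealB p q : J p -> J q -> J (p - q). Proof. by move=> Jp /idealN; apply: idealD. Qed.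
Lemma ideal_sum (I : Type) (r : seq I) (P : pred I) (F : I -> freealg D) :
  (forall i, P i -> J (F i)) -> J (\sum_(i <- r | P i) F i).
Proof. by move=> JF; apply: big_ind => //; [exact: ideal0 | exact: idealD]. Qed.
Lemma ideal_subst phi p : graded_subst phi -> J p -> J (subst phi p).
Proof. by case: Jwg => [_]; apply. Qed.
End Ideal.

(** * Rewriting words modulo the generators of [I] *)

Section ModuloI.
Variables (K : freealg D -> Prop) (Kwg : wg_ideal K).
Hypothesis K_gens : forall p, I_gens p -> K p.

Definition sign_eq s t := exists e : bool, K (mon s - (-1) ^+ e *: mon t).

Lemma sign_eq_refl s : sign_eq s s.
Proof. by exists false; rewrite expr0 scale1r subrr; apply: ideal0. Qed.

Lemma sign_eq_sym s t : sign_eq s t -> sign_eq t s.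
Proof.
move=> [e Ke]; exists e; have := idealN Kwg (idealZ Kwg ((-1) ^+ e) Ke).
by rewrite scalerBr scalerA -expr2 sqrr_sign scale1r opprB.
Qed.

Lemma sign_eq_trans t s r : sign_eq s t -> sign_eq t r -> sign_eq s r.
Proof.
move=> [e Ke] [f Kf]; exists (e (+) f).
have := idealD Kwg Ke (idealZ Kwg ((-1) ^+ e) Kf).
by rewrite scalerBr scalerA addrA subrK signr_addb.
Qed.

Lemma sign_eq_cat u v s t : sign_eq s t -> sign_eq (u ++ s ++ v) (u ++ t ++ v).
Proof.
move=> [e Ke]; exists e.
have := idealMl Kwg (mon u) (idealMr Kwg (mon v) Ke).
by rewrite mulrBl mulrBr -scalerAl -scalerAr_malg !mon_cat.
Qed.

Definition equiv s t := sign_eq s t /\ same_content s t.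

Lemma equiv_refl s : equiv s s.
Proof. by split; [exact: sign_eq_refl | exact: same_content_refl]. Qed.

Lemma equiv_trans t s r : equiv s t -> equiv t r -> equiv s r.
Proof.
move=> [st stc] [tr trc]; split; first exact: sign_eq_trans tr.
exact: same_content_trans trc.
Qed.

Lemma equiv_cons x s t : equiv s t -> equiv (x :: s) (x :: t).
Proof.
move=> [st stc]; split; last exact: same_content_cons.
by have := sign_eq_cat [:: x] [::] st; rewrite !cats0.
Qed.

(** Carries a relation between fixed variables over to arbitrary ones, since a renaming that
    respects the grading is a graded substitution. *)
Lemma rename_gen (r : var -> var) s t (e : bool) :
  (forall x, is_z (r x) = is_z x) ->
  K (mon s - (-1) ^+ e *: mon t) -> sign_eq (map r s) (map r t).
Proof.
move=> rz Kst; exists e; have := ideal_subst Kwg (graded_xvar rz) Kst.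
by rewrite substB substZ !subst_xvar_mon.
Qed.

Lemma sign_eq_yy i j : sign_eq [:: inl i; inl j] [:: inl j; inl i].
Proof.
pose r (x : var) : var := match x with inl k => inl (if k == 0%N then i else j) | z => z end.
apply: (@rename_gen r [:: inl 0%N; inl 1%N] [:: inl 1%N; inl 0%N] false) => [[]//|].
by rewrite expr0 scale1r (mon_cat [:: _] [:: _]) (mon_cat [:: _] [:: inl 0%N]) -!xvarE;
   apply: K_gens; left.
Qed.

Lemma sign_eq_yz i j : sign_eq [:: inl i; inr j] [:: inr j; inl i].
Proof.
pose r (x : var) : var := match x with inl k => inl i | inr k => inr j end.
apply: (@rename_gen r [:: inl 0%N; inr 0%N] [:: inr 0%N; inl 0%N] true) => [[]//|].
rewrite expr1 scaleN1r opprK (mon_cat [:: _] [:: _]) (mon_cat [:: _] [:: inl 0%N]) -!xvarE.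
by apply: K_gens; right; right.
Qed.

Lemma sign_eq_zzz i j k :
  sign_eq [:: inr i; inr j; inr k] [:: inr k; inr j; inr i].
Proof.
pose r (x : var) : var := match x with
  | inr 0%N => inr i | inr 1%N => inr j | inr _ => inr k | y => y end.
apply: (@rename_gen r [:: inr 0%N; inr 1%N; inr 2%N]
                      [:: inr 2%N; inr 1%N; inr 0%N] false) => [[|[|[]]]//|].
rewrite expr0 scale1r (mon_cat [:: _; _] [:: _]) (mon_cat [:: _] [:: _]).
rewrite (mon_cat [:: _; _] [:: inr 0%N]) (mon_cat [:: _] [:: inr 1%N]) -!xvarE.
by apply: K_gens; right; left.
Qed.

Lemma equiv_yy i j s : equiv (inl i :: inl j :: s) (inl j :: inl i :: s).
Proof.
split; first exact: (sign_eq_cat [::] s (sign_eq_yy i j)).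
by split=> //=; rewrite (perm_catCA [:: i] [:: j]).
Qed.

Lemma equiv_zy i j s : equiv (inr j :: inl i :: s) (inl i :: inr j :: s).
Proof.
split; first exact: (sign_eq_cat [::] s (sign_eq_sym (sign_eq_yz i j))).
by split=> //= -[].
Qed.

Lemma equiv_zzz i j k s :
  equiv (inr i :: inr j :: inr k :: s) (inr k :: inr j :: inr i :: s).
Proof.
split; first exact: (sign_eq_cat [::] s (sign_eq_zzz i j k)).
by split=> //= -[] //=; rewrite (perm_catCA [:: i] [:: k]).
Qed.

Lemma y_front i s : i \in y_letters s -> exists s', equiv s (inl i :: s').
Proof.
elim: s => // -[j|j] s IH /=.
  rewrite inE => /predU1P [->|/IH [s' ss']]; first by exists s; apply: equiv_refl.
  by exists (inl j :: s'); apply: equiv_trans (equiv_yy j i s'); apply: equiv_cons.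
move=> /IH [s' ss']; exists (inr j :: s').
by apply: equiv_trans (equiv_zy i j s'); apply: equiv_cons.
Qed.

(** Strong induction on length. If another z, of index [k], comes first, then [j] is in an even
    position of the rest. Bring some odd-position [h] of the rest to its front, then [j] right
    behind it, and exchange [k] and [j] across [h]. *)
Lemma z_front j s : j \in z_letters false s -> exists s', equiv s (inr j :: s').
Proof.
have [n] := ubnP (size s); elim: n s j => // n IH [|[i|k] s] j //= ltsn.
  move=> /IH [//|s' ss']; exists (inl i :: s').
  apply: equiv_trans (equiv_cons _ ss') _.
  split; first exact: (sign_eq_cat [::] s' (sign_eq_yz i j)).
  by split=> //= -[].
rewrite inE => /predU1P [->|j_s]; first by exists s; apply: equiv_refl.
have : (0 < size (z_letters false s))%N.
  by rewrite size_z_letters; case: (z_letters true s) j_s.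
case E: (z_letters false s) => [//|h l] _.
have [//||s2 s_s2] := IH s h; first by rewrite E mem_head.
have [s2y s2z] := s_s2.2.
have j_s2 : j \in z_letters false s2 by rewrite -(perm_mem (s2z true)).
have [||s3 s23] := IH s2 j => //.
  by have /= := same_content_size s_s2.2; move: ltsn; lia.
exists (inr h :: inr k :: s3).
apply: equiv_trans (equiv_cons _ s_s2) _.
apply: equiv_trans (equiv_cons _ (equiv_cons _ s23)) _.
exact: equiv_zzz.
Qed.

(** The first letter of [s] can be brought to the front of [t] up to sign; cancelling it leaves
    shorter words of equal content. *)
Lemma same_content_sign_eq s t : same_content s t -> sign_eq s t.
Proof.
elim: s t => [|x s IH] t st.
  by case: t st => [_|x t /same_content_size //]; apply: sign_eq_refl.
have [t' tt'] : exists t', equiv t (x :: t').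
  case: x st => i [sty stz]; [apply: y_front | apply: z_front].
    by rewrite -(perm_mem sty) mem_head.
  by rewrite -(perm_mem (stz false)) mem_head.
apply: sign_eq_trans (sign_eq_sym tt'.1).
have := same_content_trans st tt'.2; case: x {st tt'} => i [sty stz].
  have /IH [e Ke] : same_content s t'.
    by split=> [|b]; [move: sty | have := stz b]; rewrite /= ?perm_cons.
  by have := sign_eq_cat [:: inl i] [::] (ex_intro _ e Ke); rewrite !cats0.
(* Removing a leading z interchanges the two position classes. *)
have /IH [e Ke] : same_content s t'.
  by split=> [|[]] //; [have := stz false | have := stz true]; rewrite /= ?perm_cons.
by have := sign_eq_cat [:: inr i] [::] (ex_intro _ e Ke); rewrite !cats0.
Qed.

(** * Leading words and coefficients *)

Inductive mod_span (P : seq var -> Prop) : freealg D -> Prop :=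
  | mod_span_K p : K p -> mod_span P p
  | mod_span_mon s : P s -> mod_span P (mon s)
  | mod_span_D p q : mod_span P p -> mod_span P q -> mod_span P (p + q)
  | mod_span_Z c p : mod_span P p -> mod_span P (c *: p).

Lemma mod_span_mono (P Q : seq var -> Prop) p :
  (forall s, P s -> Q s) -> mod_span P p -> mod_span Q p.
Proof.
move=> PQ; elim=> [q Kq|s /PQ Qs|q r _ + _|c q _].
- exact: mod_span_K.
- exact: mod_span_mon.
- exact: mod_span_D.
- exact: mod_span_Z.
Qed.

Lemma mod_span_all p : mod_span (fun=> True) p.
Proof.
rewrite (monalg_monE p); apply: big_ind => [|q r|m _].
- by apply: mod_span_K; apply: ideal0.
- exact: mod_span_D.
- by apply: mod_span_Z; apply: mod_span_mon.
Qed.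

(** The coefficient [c] may be zero, so [s] only bounds the words of [p] modulo [K] from above. *)
Definition leads p s c :=
  mod_span (fun m => colex (content m) (content s)) (p - c *: mon s).

Lemma leads_add_lt p q s t c d : colex (content s) (content t) ->
  leads p s c -> leads q t d -> leads (p + q) t d.
Proof.
move=> lt_st ps qt; rewrite /leads.
have -> : p + q - d *: mon t = (p - c *: mon s) + (c *: mon s + (q - d *: mon t)).
  by rewrite addrA subrK addrA.
apply: mod_span_D; last by apply: mod_span_D => //; apply: mod_span_Z; apply: mod_span_mon.
by apply: mod_span_mono ps => m ltm; apply: colex_trans lt_st.
Qed.

Lemma leads_scale a p s c : leads p s c -> leads (a *: p) s (a * c).
Proof. by move=> ps; rewrite /leads -scalerA -scalerBr; exact: mod_span_Z. Qed.

(** The two words agree up to sign modulo [K], and the sign is moved onto [p]. *)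
Lemma leads_same_content p s t c :
  same_content s t -> leads p s c -> exists e : bool, leads ((-1) ^+ e *: p) t c.
Proof.
move=> st ps; have [e Ke] := same_content_sign_eq (same_content_sym st).
exists e; rewrite /leads.
have -> : (-1) ^+ e *: p - c *: mon t
        = (-1) ^+ e *: (p - c *: mon s) - c *: (mon t - (-1) ^+ e *: mon s).
  rewrite !scalerBr opprB !scalerA [c * _]mulrC addrA subrK //.
apply: mod_span_D; last by apply: mod_span_K; apply: idealN => //; apply: idealZ.
apply: mod_span_Z; apply: mod_span_mono ps => m; apply: colex_perm => //.
exact: perm_content.
Qed.

(** Induction on the derivation. In a sum the colex-larger leading word wins; for equal contents the
    coefficients add up to sign. Retaining [P] lets a bound on the spanning words pass to the
    leading word. *)
Lemma leads_exists (P : seq var -> Prop) p :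
  mod_span P p -> K p \/ exists s c, P s /\ leads p s c.
Proof.
elim=> {p} [p Kp|s Ps|p q spp IHp spq IHq|a p spp IHp]; first by left.
- right; exists s, 1; split; first exact: Ps. rewrite /leads scale1r subrr.
  by apply: mod_span_K; apply: ideal0.
- have leadsK p' q' s c : K p' -> leads q' s c -> leads (p' + q') s c.
    by move=> Kp' lq; rewrite /leads -addrA; exact: mod_span_D (mod_span_K _ Kp') lq.
  case: IHp => [Kp|[s [c [Ps ps]]]].
    case: IHq => [Kq|[t [d [Pt qt]]]]; first by left; apply: idealD.
    by right; exists t, d; split; [exact: Pt | exact: leadsK].
  right; case: IHq => [Kq|[t [d [Pt qt]]]].
    by exists s, c; split; [exact: Ps | rewrite addrC; exact: leadsK].
  case: (colex_total (content s) (content t)) => [/content_perm st|lt|lt].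
  + have [e pt] := leads_same_content st ps; exists t, ((-1) ^+ e * c + d).
    split; first exact: Pt.
    have {}pt := leads_scale ((-1) ^+ e) pt.
    rewrite scalerA -expr2 sqrr_sign scale1r in pt.
    rewrite /leads scalerDl opprD addrACA; exact: mod_span_D pt qt.
  + exists t, d; split; [exact: Pt | exact: leads_add_lt ps qt].
  + exists s, c; split; [exact: Ps | rewrite addrC; exact: leads_add_lt qt ps].
case: IHp => [Kp|[s [c [Ps ps]]]]; first by left; apply: idealZ.
right; exists s, (a * c); split; [exact: Ps | exact: leads_scale].
Qed.

Definition translate u f p := mon u * subst (fun x => xvar D (rename f x)) p.

Lemma is_z_rename f x : is_z (rename f x) = is_z x. Proof. by case: x. Qed.

Lemma ideal_translate J u f p : wg_ideal J -> J p -> J (translate u f p).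
Proof.
move=> Jwg Jp; apply: idealMl => //; apply: ideal_subst => //.
exact: graded_xvar (is_z_rename f).
Qed.

(** Translation preserves [K] and is strictly monotone on contents, so lower words stay below the
    image of [s]. *)
Lemma leads_translate u f p s c : {homo f : i j / (i < j)%N} -> z_parity u = false ->
  leads p s c -> leads (translate u f p) (u ++ map (rename f) s) c.
Proof.
move=> finc u_even; rewrite /leads => ps.
have -> : translate u f p - c *: mon (u ++ map (rename f) s)
        = translate u f (p - c *: mon s).
  rewrite /translate substB substZ subst_xvar_mon mulrBr mon_cat scalerAr_malg //.
elim: ps => [q Kq|m ltm|q r _ + _|a q _].
- by apply: mod_span_K; apply: ideal_translate.
- rewrite /translate subst_xvar_mon -mon_cat; apply: mod_span_mon.
  exact: colex_translate.
- by rewrite /translate substD mulrDr; apply: mod_span_D.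
- by rewrite /translate substZ -scalerAr_malg; apply: mod_span_Z.
Qed.
End ModuloI.
End FreeAlgebra.

(** * The Hilbert basis argument *)

Lemma noetherian_dependence (D : idomainType) (c : nat -> D) :
  noetherian D -> exists N (d : nat -> D), c N = \sum_(i < N) d i * c i.
Proof.
(* [A n] is the ideal generated by the first [n] terms. Once the chain is stationary at [N], the
   term [c N] of [A N.+1] already lies in [A N]. *)
move=> noethD; pose A n x := exists d : nat -> D, x = \sum_(i < n) d i * c i.
have [n|n x [d ->]|N AN] := noethD A.
- split.
  + by exists (fun=> 0); rewrite big1 // => i _; rewrite mul0r.
  + move=> _ _ [d ->] [e ->]; exists (fun i => d i + e i).
    by rewrite -big_split; apply: eq_bigr => i _; rewrite mulrDl.
  + move=> a _ [d ->]; exists (fun i => a * d i).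
    by rewrite mulr_sumr; apply: eq_bigr => i _; rewrite mulrA.
- exists (fun i => if (i < n)%N then d i else 0).
  rewrite big_ord_recr /= ltnn mul0r addr0.
  by apply: eq_bigr => i _; rewrite ltn_ord.
have [|d cN] := AN N.+1 (c N) (leqnSn N); last by exists N, d.
exists (fun i => (i == N)%:R); rewrite big_ord_recr /= eqxx mul1r big1 ?add0r //.
by move=> i _; rewrite ltn_eqF ?mul0r.
Qed.

Lemma mem_seq3 (T : eqType) (a b c x : T) :
  x \in [:: a; b; c] <-> x = a \/ x = b \/ x = c.
Proof.
rewrite !inE; split=> [/or3P [] /eqP|]; auto.
by case=> [|[]] /eqP ->; rewrite ?orbT.
Qed.

Lemma wg_generated_mono (D : idomainType) (S T : freealg D -> Prop) p :
  (forall q, S q -> T q) -> wg_generated S p -> wg_generated T p.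
Proof. by move=> ST Gp J Jwg TJ; apply: Gp => // q /ST; apply: TJ. Qed.

Theorem mainTheorem16 (D : idomainType) :
  infinite_type D -> noetherian D ->
  forall J : freealg D -> Prop,
    wg_ideal J ->
    (forall p, I_ideal p -> J p) ->
    exists S : seq (freealg D),
      (forall p, p \in S -> J p) /\
      (forall p, J p <-> wg_generated (fun q => q \in S) p).
Proof.
move=> _ noethD J Jwg IJ; apply: NNPP => not_fg.
pose gens : seq (freealg D) :=
  [:: lie_br (yv D 0) (yv D 1);
      zv D 0 * zv D 1 * zv D 2 - zv D 2 * zv D 1 * zv D 0;
      yv D 0 * zv D 0 + zv D 0 * yv D 0].
have gensP p : p \in gens <-> I_gens p by apply: mem_seq3.
(* Every [G S] contains the generators of [I], hence [K]. *)
pose K := @I_ideal D; pose G S := wg_generated (fun q => q \in gens ++ S).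
have Kwg : wg_ideal K := wg_generated_wg_ideal _.
have Kgens p : I_gens p -> K p by move=> Ip J' _; apply.
have Gwg S : wg_ideal (G S) := wg_generated_wg_ideal _.
have KG S p : K p -> G S p.
  by apply: wg_generated_mono => q /gensP q_gens; rewrite mem_cat q_gens.
pose new S (x : freealg D * seq var * D) :=
  [/\ J x.1.1, ~ G S x.1.1 & leads K x.1.1 x.1.2 x.2].
(* Given a finite part [S] of [J], choose an element of [J] outside [G S] with colex-minimal leading
   word; other lists get a dummy triple. *)
have /functional_choice [step stepP] : forall S, exists x,
    (forall q, q \in S -> J q) ->
    new S x /\ forall y, new S y -> ~ colex (content y.1.2) (content x.1.2).
  move=> S; case: (classic (forall q, q \in S -> J q)) => [SJ|]; last first.
    by exists (0, [::], 0).
  have [|x newx minx] := wf_minimal (P := new S)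
      (wf_inverse_image _ _ _ (fun x => content x.1.2) colex_wf); last by exists x.
  (* Otherwise the finite list [gens ++ S] would generate [J]. *)
  have [p [Jp nGp]] : exists p, J p /\ ~ G S p.
    apply: NNPP => all_G; apply: not_fg; exists (gens ++ S).
    have SJ' p : p \in gens ++ S -> J p.
      rewrite mem_cat => /orP [/gensP Ip|/SJ //]; exact: IJ (Kgens _ Ip).
    split=> // p; split=> [Jp|]; last by apply.
    by apply: NNPP => nGp; apply: all_G; exists p.
  have [Kp|[s [c [_ ps]]]] := leads_exists Kwg Kgens (mod_span_all Kwg p).
    by case: nGp; apply: KG.
  by exists (p, s, c).
(* [u n] lists the first [n] chosen polynomials, and [x n] is the next choice. *)
pose u := fix u n := if n is n'.+1 then (step (u n')).1.1 :: u n' else [::].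
have uJ n q : q \in u n -> J q.
  elim: n q => // n IH q; rewrite inE => /predU1P [->|/IH //].
  by have [[]] := stepP (u n) IH.
pose x n := step (u n).
have xP n := stepP (u n) (uJ n).
have x_in_u m n : (m < n)%N -> (x m).1.1 \in u n.
  elim: n => // n IH; rewrite ltnS leq_eqVlt inE => /predU1P [->|/IH ->].
    by rewrite eqxx.
  by rewrite orbT.
(* Along [g] each leading word divides all later ones, and some leading coefficient is a combination
   of the preceding ones. *)
have [g ginc gP] := word_le_ascending (fun n => (x n).1.2).
have [N [d cN]] := noetherian_dependence (fun n => (x (g n)).2) noethD.
set s := (x (g N)).1.2 in gP; set M := g N.
(* Each earlier [x (g i)] is moved onto the leading word [s]. *)
have /functional_choice [q qP] : forall i, exists q, (i < N)%N ->
    [/\ J q, G (u M) q & leads K q s (x (g i)).2].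
  move=> i; case: (ltnP i N) => [ltiN|]; last by exists 0.
  have [f [v [finc v_even same]]] := word_le_divides (gP i N ltiN).
  have [[Jx _ lx] _] := xP (g i).
  have [e lq] := leads_same_content Kwg Kgens same (leads_translate Kwg finc v_even lx).
  exists ((-1) ^+ e *: translate v f (x (g i)).1.1) => _; split.
  - exact: (idealZ Jwg) (ideal_translate _ _ Jwg Jx).
  - apply: (idealZ (Gwg _)); apply: (ideal_translate _ _ (Gwg _)) => J' _; apply.
    by rewrite mem_cat x_in_u ?orbT //; apply: ginc.
  - exact: lq.
have [[JxM nGM lxM] minM] := xP M.
set p := (x M).1.1 in JxM nGM lxM.
(* The dependence relation gives [r] the leading word and coefficient of [p], while [r] lies in the
   ideal of the earlier choices. *)
pose r := \sum_(i < N) d i *: q i.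
have GrM : G (u M) r.
  by apply: (ideal_sum (Gwg _)) => i _; apply: (idealZ (Gwg _)); case: (qP i (ltn_ord i)).
have lr : leads K r s (\sum_(i < N) d i * (x (g i)).2).
  rewrite /leads scaler_suml -sumrB; apply: big_ind => [|p1 p2|i _].
  - exact: mod_span_K (ideal0 Kwg).
  - exact: mod_span_D.
  - by have [_ _] := qP i (ltn_ord i); apply: leads_scale.
have sp : mod_span K (fun m => colex (content m) (content s)) (p - r).
  have -> : p - r = (p - (x M).2 *: mon D s) + (-1) *: (r - (x M).2 *: mon D s).
    by rewrite scaleN1r opprB addrA subrK.
  apply: mod_span_D; first exact: lxM.
  by apply: mod_span_Z; rewrite cN; exact: lr.
have nGpr : ~ G (u M) (p - r).
  by move=> Gpr; apply: nGM; rewrite -(subrK r p); exact: (idealD (Gwg _)) Gpr GrM.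
have Jr : J r.
  by apply: (ideal_sum Jwg) => i _; apply: (idealZ Jwg); case: (qP i (ltn_ord i)).
(* The difference [p - r] is in [J] but not in [G (u M)]. So it is not in [K], and its leading word
   below [s] contradicts the minimal choice of [x M]. *)
have [Kpr|[t [c [lt_ts lpr]]]] := leads_exists Kwg Kgens sp.
  by case: (nGpr (KG _ _ Kpr)).
by apply: (minM (p - r, t, c)) lt_ts; split; [exact: (idealB Jwg) | exact: nGpr | exact: lpr].
Qed.
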